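(* Let $\varepsilon,\gamma,\tau>0$, let $F\in C^2(\mathbf R)$ and $f=F'$ with $\max_{\phi\in\mathbf R}|f'(\phi)|\le L$ for a constant $L\ge 0$, and let $A,B\ge 0$ be constants satisfying $$A\geq \frac{L^{2}}{16\varepsilon^{2}}\gamma, \qquad B\geq \frac{L}{2\varepsilon}.$$ Let $\phi^0,\phi^1$ be given and let $\phi^{n+1},\mu^{n+\frac12}$, $n\ge1$, be produced by the stabilized linear diffusive Crank--Nicolson (SLD-CN) scheme $$\frac{\phi^{n+1}-\phi^{n}}{\tau}=\gamma\Delta \mu^{n+\frac{1}{2}},$$ $$\mu^{n+\frac{1}{2}}=-\varepsilon \Delta \Big(\frac{3\phi^{n+1}+\phi^{n-1}}{4} \Big)+\frac{1}{\varepsilon}f\Big(\frac{3}{2}\phi^{n}-\frac{1}{2}\phi^{n-1}\Big)-A\tau \Delta \delta_{t}\phi^{n+1}+B\,\delta_{tt}\phi^{n+1}$$ in $\Omega$, with homogeneous Neumann boundary conditions. Then for all $n\ge 1$ $$E_{C}^{n+1}\leq E_{C}^{n}-\Big(2\sqrt{\tfrac{A}{\gamma}}-\tfrac{L}{2\varepsilon}\Big)\|\delta_{t}\phi^{n+1}\|^{2}-\Big(\tfrac{B}{2}-\tfrac{L}{4\varepsilon}\Big)\|\delta_{tt}\phi^{n+1}\|^{2}-\frac{\varepsilon}{8}\|\nabla\delta_{tt} \phi^{n+1}\|^{2},$$ where $$E_{C}^{n+1}=E_{\varepsilon}(\phi^{n+1})+\Big(\frac{L}{4\varepsilon}+\frac{B}{2}\Big)\|\delta_{t}\phi^{n+1}\|^{2}+\frac{\varepsilon}{8}\|\nabla\delta_t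 \phi^{n+1}\|^{2}.$$
   Context: $\Omega\subset\mathbf R^d$, $d\in\{1,2,3\}$, is a bounded domain with (for $d=2,3$) locally Lipschitz boundary; $\|\cdot\|$ is the $L^2(\Omega)$ norm. The energy is $E_{\varepsilon}(\phi)=\int_{\Omega}\big(\frac{\varepsilon}{2}|\nabla \phi|^{2}+\frac{1}{\varepsilon} F(\phi)\big)dx$. Notation: $\delta_t\phi^{n+1}=\phi^{n+1}-\phi^n$, $\delta_{tt}\phi^{n+1}=\phi^{n+1}-2\phi^n+\phi^{n-1}$. The scheme discretizes in time (step size $\tau$) the Cahn--Hilliard equation $\phi_t=\gamma\Delta\mu$, $\mu=-\varepsilon\Delta\phi+\frac1\varepsilon f(\phi)$ with Neumann boundary conditions $\partial_n\phi=\partial_n\mu=0$ on $\partial\Omega$. The equations of the scheme, with the homogeneous Neumann conditions $\partial_n\phi^n=0$, $\partial_n\mu^{n+\frac12}=0$, are understood in the weak sense: $\phi^n,\mu^{n+\frac12}\in H^1(\Omega)$, the equations are tested against arbitrary functions in $H^1(\Omega)$, and each term $-\Delta u$ tested against $v$ is read as $(\nabla u,\nabla v)$. *)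

(* Defs.v *)
From HB Require Import structures.
From mathcomp Require Import all_boot all_order all_algebra.
From mathcomp Require Import all_classical all_reals all_analysis.

Set Implicit Arguments.
Unset Strict Implicit.
Unset Printing Implicit Defensive.

Import Order.TTheory GRing.Theory Num.Theory.
Import numFieldNormedType.Exports.

Local Open Scope classical_set_scope.
Local Open Scope ring_scope.

Definition rV_display : measure_display. Proof. exact. Qed.

Section measurable_rV.
Context {R : realType} {n : nat}.

Let coord (i : 'I_n) (x : 'rV[R]_n) : R := x ord0 i.

Let rV_set0 : g_sigma_preimage coord set0.
Proof. exact: sigma_algebra0. Qed.

Let rV_setC A : g_sigma_preimage coord A -> g_sigma_preimage coord (~` A).
Proof. exact: sigma_algebraC. Qed.

Let rV_bigcup (F : (set 'rV[R]_n)^nat) :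
  (forall i, g_sigma_preimage coord (F i)) ->
  g_sigma_preimage coord (\bigcup_i (F i)).
Proof. exact: sigma_algebra_bigcup. Qed.

(* The product sigma-algebra, i.e. the Borel sets of R^n. *)
HB.instance Definition _ := @isMeasurable.Build rV_display
  'rV[R]_n (g_sigma_preimage coord) rV_set0 rV_setC rV_bigcup.

Lemma measurable_coord (i : 'I_n) :
  measurable_fun [set: 'rV[R]_n] (fun x => x ord0 i).
Proof.
move=> _ Y mY; rewrite setTI; apply: sub_sigma_algebra => /=.
rewrite -bigcup_seq/=; exists i => /=; first by rewrite mem_index_enum.
by exists Y => //; rewrite setTI.
Qed.

Lemma measurable_fun_rV d (T : measurableType d) (f : T -> 'rV[R]_n) :
  (forall i, measurable_fun [set: T] (fun t => f t ord0 i)) ->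
  measurable_fun [set: T] f.
Proof.
move=> mf.
suff fS : g_sigma_preimage (fun i => coord i \o f) `<=` measurable.
  by move=> _ A mA; apply: fS; rewrite g_sigma_preimage_comp; exists A.
apply: smallest_sub; first exact: sigma_algebra_measurable.
rewrite -bigcup_seq => A [i _ [B mB <-]]; exact: mf.
Qed.

End measurable_rV.

Section lebesgue_rV.
Context {R : realType}.

Definition cons_rV n (p : measurableTypeR R * 'rV[R]_n) : 'rV[R]_n.+1 :=
  \row_i if unlift ord0 i is Some j then p.2 ord0 j else p.1.

Lemma measurable_cons_rV n :
  measurable_fun [set: measurableTypeR R * 'rV[R]_n] (@cons_rV n).
Proof.
apply: measurable_fun_rV => i.
under eq_fun do rewrite mxE.
case: (unliftP ord0 i) => [j|] _.
  by apply: (measurableT_comp (measurable_coord j)); exact: measurable_snd.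
exact: (@measurable_fst _ _ (measurableTypeR R)).
Qed.

Section step.
Context n (m : {sigma_finite_measure set 'rV[R]_n -> \bar R}).

Definition lebesgue_step : set 'rV[R]_n.+1 -> \bar R :=
  pushforward (@lebesgue_measure R \x m)%E (@cons_rV n).

Let lebesgue_step0 : lebesgue_step set0 = 0%E.
Proof. by rewrite /lebesgue_step /pushforward preimage_set0 measure0. Qed.

Let lebesgue_step_ge0 A : (0 <= lebesgue_step A)%E.
Proof. by rewrite /lebesgue_step /pushforward; exact: measure_ge0. Qed.

Let lebesgue_step_sigma_additive : semi_sigma_additive lebesgue_step.
Proof.
have mF A : measurable A -> measurable (@cons_rV n @^-1` A).
  by move=> mA; rewrite -[X in measurable X]setTI; exact: measurable_cons_rV.
move=> F mF' tF mUF; rewrite /lebesgue_step /pushforward preimage_bigcup.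
apply: measure_semi_sigma_additive.
- by move=> k; exact: mF.
- apply/trivIsetP => i j _ _ ij; rewrite -preimage_setI.
  by move/trivIsetP : tF => /(_ _ _ _ _ ij) ->//; rewrite preimage_set0.
- by rewrite -preimage_bigcup; exact: mF.
Qed.

HB.instance Definition _ := isMeasure.Build _ _ _ lebesgue_step
  lebesgue_step0 lebesgue_step_ge0 lebesgue_step_sigma_additive.

Let lebesgue_step_sigma_finite : sigma_finite setT lebesgue_step.
Proof.
have /sigma_finiteP[F [TF ndF Foo]] := sigma_finiteT (@lebesgue_measure R).
have /sigma_finiteP[G [TG ndG Goo]] := sigma_finiteT m.
pose g (x : 'rV[R]_n.+1) : measurableTypeR R * 'rV[R]_n :=
  (x ord0 ord0, \row_j x ord0 (lift ord0 j)).
have mg : measurable_fun [set: _] g.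
  apply/measurable_fun_pairP; split; first exact: measurable_coord.
  apply: measurable_fun_rV => i; rewrite /comp/=.
  under eq_fun do rewrite mxE.
  exact: measurable_coord.
have gK p : g (cons_rV p) = p.
  case: p => x v; rewrite /g mxE unlift_none; congr pair.
  by apply/rowP => j; rewrite !mxE liftK.
exists (fun k => g @^-1` (F k `*` G k)) => [|k].
  apply/esym; rewrite -subTset => x _.
  have [k1 _ Fk1] : (\bigcup_k F k) (g x).1 by rewrite -TF.
  have [k2 _ Gk2] : (\bigcup_k G k) (g x).2 by rewrite -TG.
  exists (maxn k1 k2) => //; split => /=.
  - by move: Fk1; exact/subsetPset/ndF/leq_maxl.
  - by move: Gk2; exact/subsetPset/ndG/leq_maxr.
have [mFk Fk] := Foo k; have [mGk Gk] := Goo k; split.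
  by rewrite -[X in measurable X]setTI; apply: mg => //; exact: measurableX.
rewrite /lebesgue_step /pushforward -comp_preimage (_ : g \o _ = id); last first.
  exact/funext.
by rewrite preimage_id product_measure1E//= lte_mul_pinfty// ge0_fin_numE.
Qed.

HB.instance Definition _ := @Measure_isSigmaFinite.Build _ _ _
  lebesgue_step lebesgue_step_sigma_finite.

End step.

Fixpoint lebesgue_rV n : {sigma_finite_measure set 'rV[R]_n -> \bar R} :=
  if n is n'.+1 then lebesgue_step (lebesgue_rV n') else dirac (0 : 'rV[R]_0).

Lemma lebesgue_rV_box n (A : 'I_n -> set (measurableTypeR R)) :
  (forall i, measurable (A i)) ->
  lebesgue_rV n [set x | forall i, A i (x ord0 i)] =
  (\prod_(i < n) lebesgue_measure (A i))%E.
Proof.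
elim: n A => [|n IHn] A mA.
  by rewrite big_ord0 /= diracE mem_set// => -[].
have mB : measurable [set x : 'rV[R]_n | forall j, A (lift ord0 j) (x ord0 j)].
  rewrite (_ : [set x | _] =
    \bigcap_(j in [set: 'I_n]) (fun x : 'rV[R]_n => x ord0 j) @^-1` A (lift ord0 j)).
    apply: fin_bigcap_measurable => [|j _]; first exact: finite_finset.
    by rewrite -[X in measurable X]setTI; apply: measurable_coord => //; exact: mA.
  by apply/seteqP; split => x /= Ax j => [_|]; exact: Ax.
rewrite big_ord_recl -IHn//= /lebesgue_step /pushforward.
rewrite (_ : _ @^-1` _ = A ord0 `*`
    [set x : 'rV[R]_n | forall j, A (lift ord0 j) (x ord0 j)]).
  by rewrite product_measure1E.
apply/seteqP; split => -[x v]/=.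
  move=> Axv; split => [|j].
    by have := Axv ord0; rewrite mxE unlift_none.
  by have := Axv (lift ord0 j); rewrite mxE liftK.
move=> [Ax Av] i; rewrite mxE; case: (unliftP ord0 i) => [j|] -> //.
Qed.

End lebesgue_rV.

Section domains.
Context {R : realType} {d : nat}.
Implicit Type Omega : set 'rV[R]_d.

Definition bounded_domain Omega :=
  [/\ open Omega, connected Omega, Omega !=set0 & bounded_set Omega].

(* For open Omega, closure Omega `\` Omega is the boundary.  Near each boundary
   point and after an orthogonal change of coordinates y |-> y *m Q, Omega is the strict hypograph, in the i-th direction, of a
   Lipschitz function of the remaining coordinates. *)
Definition locally_lipschitz_boundary Omega :=
  forall x, (closure Omega `\` Omega) x ->
  exists (Q : 'M[R]_d) (i : 'I_d) (g : 'rV[R]_d.-1 -> R^o),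
    [/\ Q *m Q^T = 1%:M,
        [lipschitz g z | z in setT] &
        \forall y \near x,
          Omega y <-> (y *m Q) ord0 i < g (col' i (y *m Q))].

End domains.

Section sobolev.
Context {R : realType} {d : nat}.
Local Notation T := 'rV[R]_d.
Local Notation leb := (@lebesgue_rV R d).
Implicit Types (Omega : set T) (u v : T -> R) (g h : T -> T).

Definition basis_vec (i : 'I_d) : T := delta_mx ord0 i.

Fixpoint Ck (k : nat) (psi : T -> R^o) : Prop :=
  continuous psi /\
  if k is k'.+1 then forall i : 'I_d,
    (forall x, derivable psi x (basis_vec i)) /\ Ck k' ('D_(basis_vec i) psi)
  else True.

Definition test_function Omega (psi : T -> R^o) :=
  [/\ forall k, Ck k psi,
      compact (closure [set x | psi x != 0]) &
      closure [set x | psi x != 0] `<=` Omega].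

Definition dotv (a b : T) : R := \sum_(i < d) a ord0 i * b ord0 i.

Definition L2 Omega u :=
  measurable_fun Omega u /\ leb.-integrable Omega (fun x => (u x ^+ 2)%:E).

Definition ip Omega u v : R := \int[leb]_(x in Omega) (u x * v x).

Definition norm2 Omega u : R := Num.sqrt (ip Omega u u).

Definition ipv Omega g h : R := \int[leb]_(x in Omega) dotv (g x) (h x).

Definition norm2v Omega g : R := Num.sqrt (ipv Omega g g).

Definition weak_gradient Omega u g :=
  forall psi, test_function Omega psi -> forall i : 'I_d,
    ip Omega u ('D_(basis_vec i) psi) = - ip Omega (fun x => g x ord0 i) psi.

(* An H^1 function is represented by a pair (u, g), where g is (a
   representative of) its weak gradient; g is determined by u up to a null set.
   The linear structure is that of the product of function spaces, so that the
   gradient of a linear combination is part of the pair. *)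
Definition H1pair : lmodType R := ((T -> R^o) * (T -> T))%type.

Definition fct (w : H1pair) : T -> R := w.1.
Definition grad (w : H1pair) : T -> T := w.2.

Definition H1 Omega : set H1pair :=
  [set w | [/\ L2 Omega (fct w),
               forall i : 'I_d, L2 Omega (fun x => grad w x ord0 i) &
               weak_gradient Omega (fct w) (grad w)]].

End sobolev.

Arguments H1pair R d : clear implicits.

Section scheme.
Context {R : realType} {d : nat}.
Local Notation T := 'rV[R]_d.
Local Notation leb := (@lebesgue_rV R d).
Variable Omega : set T.

Definition C2 (F : R -> R) :=
  [/\ forall x, derivable F x 1, forall x, derivable (derive1 F) x 1 &
      continuous (derive1 (derive1 F))].

(* delta_t phi n stands for delta_t phi^n = phi^n - phi^{n-1}, meaningful for
   n >= 1; likewise delta_tt phi n is meaningful for n >= 2. *)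
Definition delta_t (phi : nat -> H1pair R d) n := phi n - phi n.-1.
Definition delta_tt (phi : nat -> H1pair R d) n :=
  phi n - 2 *: phi n.-1 + phi n.-2.

Definition energy (eps : R) (F : R -> R) (w : H1pair R d) : R :=
  \int[leb]_(x in Omega)
    (eps / 2 * dotv (grad w x) (grad w x) + eps^-1 * F (fct w x)).

Definition modified_energy (eps L B : R) (F : R -> R)
    (phi : nat -> H1pair R d) n : R :=
  energy eps F (phi n)
  + (L / (4 * eps) + B / 2) * norm2 Omega (fct (delta_t phi n)) ^+ 2
  + eps / 8 * norm2v Omega (grad (delta_t phi n)) ^+ 2.

(* mu n stands for mu^{n+1/2}. *)
Definition SLD_CN (eps gamma tau A B : R) (f : R -> R)
    (phi mu : nat -> H1pair R d) :=
  forall n, (1 <= n)%N -> forall v, H1 Omega v ->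
    ip Omega (fct (tau^-1 *: (phi n.+1 - phi n))) (fct v) =
      - gamma * ipv Omega (grad (mu n)) (grad v)
    /\
    ip Omega (fct (mu n)) (fct v) =
      eps * ipv Omega (grad (4^-1 *: (3 *: phi n.+1 + phi n.-1))) (grad v)
      + eps^-1 * ip Omega
          (fun x => f (fct ((3 / 2) *: phi n - 2^-1 *: phi n.-1) x)) (fct v)
      + A * tau * ipv Omega (grad (delta_t phi n.+1)) (grad v)
      + B * ip Omega (fct (delta_tt phi n.+1)) (fct v).

End scheme.

(* Main.v *)
(* Write d = phi^{n+1} - phi^n and e = phi^n - phi^{n-1}.  Testing the first
   equation with mu and with d, and the second one with d, gives
     -gamma tau |grad mu|^2 = <second equation tested with d>,
     |d|^2 = -gamma tau (grad mu, grad d).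
   Expanding 0 <= gamma tau |grad mu + s grad d|^2 with s = sqrt (A / gamma)
   bounds gamma tau |grad mu|^2 + A tau |grad d|^2 below by 2 s |d|^2.  The
   quadratic terms telescope because
     (3 phi^{n+1} + phi^{n-1}) / 4 = phi^n + 3/4 d - 1/4 e,
   and the potential is controlled by expanding F(phi^{n+1}) and F(phi^n) to
   first order at the extrapolated point phi^n + e/2. *)
Require Import Defs.
From HB Require Import structures.
From mathcomp Require Import all_boot all_order all_algebra.
From mathcomp Require Import all_classical all_reals all_analysis.
From mathcomp Require Import measurable_realfun ring lra.

Set Implicit Arguments.
Unset Strict Implicit.
Unset Printing Implicit Defensive.

Import Order.TTheory GRing.Theory Num.Theory.
Import numFieldNormedType.Exports.

Local Open Scope classical_set_scope.
Local Open Scope ring_scope.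

(** * Mean value and first-order Taylor estimates on the real line *)

Section taylor.
Context {R : realType}.
Implicit Types (F : R -> R) (L x y : R).

(** The sign condition places [c] on the same side of [x] as [y], which treats both orders of [x]
    and [y] at once. *)
Lemma MVT_between F x y : (forall t, derivable F t 1) ->
  exists2 c, 0 <= (c - x) * (y - x) & F y - F x = derive1 F c * (y - x).
Proof.
move=> dF.
have cF a b : {within `[a, b], continuous F}.
  by apply: derivable_within_continuous => t _; exact: dF.
have iF (t : R) : is_derive t 1 F (derive1 F t).
  by rewrite derive1E; exact/derivableP/dF.
have [xy|/ltW yx] := leP x y.
- have [c] := MVT_segment xy (fun t _ => iF t) (cF x y).
  rewrite in_itv/= => /andP[xc cy] Fc; exists c => //.
  by rewrite mulr_ge0 ?subr_ge0.
- have [c] := MVT_segment yx (fun t _ => iF t) (cF y x).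
  rewrite in_itv/= => /andP[yc cx] Fc; exists c.
    by rewrite mulr_le0 ?subr_le0.
  by rewrite -opprB Fc -mulrN opprB.
Qed.

Lemma lipschitz_derive1 F L : (forall t, derivable F t 1) ->
  (forall t, `|derive1 F t| <= L) ->
  forall x y, `|F y - F x| <= L * `|y - x|.
Proof.
move=> dF FL x y; have [c _ ->] := MVT_between x y dF.
by rewrite normrM ler_wpM2r.
Qed.

(** For each sign [s], the mean value theorem is applied to the signed remainder minus
    [L / 2 * (t - x) ^+ 2], so only a Lipschitz bound on [derive1 F] enters. *)
Lemma taylor1_le F L : (forall t, derivable F t 1) ->
  (forall x y, `|derive1 F y - derive1 F x| <= L * `|y - x|) ->
  forall x y, `|F y - F x - derive1 F x * (y - x)| <= L / 2 * (y - x) ^+ 2.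
Proof.
move=> dF fL x y.
suff H (s : R) : s ^+ 2 = 1 ->
    s * (F y - F x - derive1 F x * (y - x)) <= L / 2 * (y - x) ^+ 2.
  rewrite ler_norml lerNl -mulN1r !H ?sqrrN ?expr1n//=.
  by rewrite -[leLHS]mul1r H ?expr1n.
move=> s2.
pose h t := s * (F t - derive1 F x * (t - x)) - L / 2 * (t - x) ^+ 2.
have ih (t : R) :
    is_derive t 1 h (s * (derive1 F t - derive1 F x) - L * (t - x)).
  have iF : is_derive t 1 F (derive1 F t).
    by rewrite derive1E; exact/derivableP/dF.
  apply: is_derive_eq; rewrite /GRing.scale/=; lra.
have [c] := @MVT_between h x y (fun t => @ex_derive _ _ _ _ _ _ _ (ih t)).
rewrite derive1E (@derive_val _ _ _ _ _ _ _ (ih c)) /h => cxy hyx.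
(* Since [c - x] and [y - x] have the same sign, the product of their absolute values is
   [(c - x) * (y - x)]; hence [h y <= h x]. *)
have sf : s * (derive1 F c - derive1 F x) * (y - x) <= L * ((c - x) * (y - x)).
  rewrite (le_trans (ler_norm _))// -[X in _ <= L * X]ger0_norm// !normrM.
  have /eqP : `|s| ^+ 2 = 1 by rewrite -normrX s2 normr1.
  rewrite sqrf_eq1 => /orP[/eqP ->|/eqP s1]; last by have := normr_ge0 s; lra.
  by rewrite mul1r mulrA ler_wpM2r.
by move: hyx sf; rewrite !mulrBr; nra.
Qed.

End taylor.

(** * Borel sets, bounded sets and continuous functions in R^d *)

Section measure_rV.
Context {R : realType} {d : nat}.
Local Notation T := 'rV[R]_d.
Local Notation leb := (@lebesgue_rV R d).

Lemma measurable_box_rV (A : 'I_d -> set (measurableTypeR R)) :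
  (forall i, measurable (A i)) ->
  measurable [set x : T | forall i, A i (x ord0 i)].
Proof.
move=> mA; rewrite (_ : [set x | _] =
    \bigcap_(j in [set: 'I_d]) (fun x : T => x ord0 j) @^-1` A j).
  apply: fin_bigcap_measurable => [|j _]; first exact: finite_finset.
  by rewrite -[X in measurable X]setTI; apply: measurable_coord => //;
    exact: mA.
by apply/seteqP; split => x /= Ax j => [_|]; exact: Ax.
Qed.

(** Balls of the sup norm are products of intervals. *)
Lemma measurable_ball_rV (x : T) (e : R) : 0 < e -> measurable (ball x e).
Proof.
move=> e0; rewrite (_ : ball x e =
    [set y : T | forall j,
      (ball (x ord0 j) e : set (measurableTypeR R)) (y ord0 j)]).
  apply: (@measurable_box_rV (fun j => ball (x ord0 j) e)) => i.
  exact: measurable_ball.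
apply/seteqP; split => y /=.
- by case=> _ xy j; exact: xy.
- by split => // i j; rewrite ord1.
Qed.

(** The sigma-algebra is generated by the coordinates, so an open set is reached through countably
    many boxes: the balls inside it with rational centre and radius 1/(k+1). *)
Lemma open_measurable_rV (U : set T) : open U -> measurable U.
Proof.
move=> oU.
pose B (p : 'rV[rat]_d * nat) : set T :=
  ball (map_mx ratr p.1 : T) p.2.+1%:R^-1.
rewrite (_ : U = \bigcup_p (if `[< B p `<=` U >] then B p else set0)).
  apply: countable_bigcupT_measurable => [|p]; first exact: countableP.
  by case: ifP => _; [exact: measurable_ball_rV|exact: measurable0].
apply/seteqP; split => x; last first.
  by case=> p _; case: ifPn => // /asboolP; exact.
move=> Ux.
have /nbhs_ballP[e /= e0 xeU] : nbhs x U by exact: open_nbhs_nbhs.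
(* With radius [r] below [e / 2] and a rational centre within [r] of [x], the ball contains [x] and,
   by the triangle inequality, stays in [ball x e]. *)
have [k _ /(_ k (leqnn _)) ke] :=
  near_infty_natSinv_lt (PosNum (divr_gt0 e0 (ltr0n R 2))).
set r := k.+1%:R^-1 in ke.
have r0 : 0 < r :> R by rewrite invr_gt0.
have Q i : {q : rat | `|ratr q - x ord0 i| < r}.
  apply: cid.
  have [q] := @rat_in_itvoo R (x ord0 i - r) (x ord0 i + r) ltac:(lra).
  by rewrite in_itv/= => xq; exists q; rewrite ltr_distl.
pose q : 'rV[rat]_d := \row_i sval (Q i).
have qx i : `|ratr (q ord0 i) - x ord0 i| < r.
  by rewrite mxE; exact: svalP (Q i).
exists (q, k) => //; rewrite ifT.
  by split => // i j; rewrite ord1 mxE; exact: qx.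
apply/asboolP => y [_ qy]; apply: xeU; split => // i j; rewrite ord1.
have := qx j; have := qy ord0 j; rewrite mxE /ball/= => qyj qxj.
rewrite (le_lt_trans (ler_distD (ratr (q ord0 j)) _ _))// distrC.
by rewrite [ltRHS]splitr ltrD// (lt_trans _ ke).
Qed.

Lemma bounded_set_box (U : set T) : bounded_set U ->
  exists M, U `<=` [set x | forall i, `[- M, M]%classic (x ord0 i : R)].
Proof.
(* Boundedness gives norms at most [K] for every [K > M]: [M + 1] is such a [K], and [M + 2] makes
   the inequality strict, as a ball requires. *)
move=> [M [_ UM]]; exists (M + 2) => x Ux i.
have [_ /(_ ord0 i)] : ball (0 : T) (M + 2) x.
  rewrite mx_norm_ball /ball_/= sub0r normrN.
  by rewrite (@le_lt_trans _ _ (M + 1)) ?UM ?ltrDl ?ltrD2l ?ltr1n.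
by rewrite mxE /ball/= sub0r normrN in_itv/= -ler_norml => /ltW.
Qed.

Lemma bounded_lebesgue_rV_fin (U : set T) : measurable U -> bounded_set U ->
  (leb U < +oo)%E.
Proof.
move=> mU /bounded_set_box[M UM].
pose A (i : 'I_d) : set (measurableTypeR R) := `[- M, M]%classic.
have mA i : measurable (A i) by exact: measurable_itv.
have mbox : measurable [set x : T | forall i, A i (x ord0 i)].
  exact: measurable_box_rV.
apply: (@le_lt_trans _ _ (leb [set x : T | forall i, A i (x ord0 i)])).
  by apply: le_measure; rewrite ?inE.
rewrite lebesgue_rV_box// -ge0_fin_numE; last exact: prode_ge0.
apply: prode_fin_num => i _.
by rewrite /A lebesgue_measure_itv/=; case: ifP.
Qed.

Lemma continuous_measurable_rV (f : T -> R) : continuous f ->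
  measurable_fun [set: T] f.
Proof.
move=> cf; apply: (measurability _ (RGenOInfty.measurableE R)).
move=> /= _ [_ [a ->]] <-; rewrite setTI; apply: open_measurable_rV.
by move/continuousP : cf; apply; exact: interval_open.
Qed.

(** The set lies in a closed cube, which is compact. *)
Lemma continuous_bounded_rV (U : set T) (f : T -> R^o) : bounded_set U ->
  continuous f -> exists2 M, 0 <= M & forall x, U x -> `|f x| <= M.
Proof.
move=> /bounded_set_box[N UN] cf.
have cB : compact [set x : T | forall i, `[- N, N]%classic (x ord0 i : R)].
  by apply: (@rV_compact _ _ (fun=> `[- N, N]%classic)) => _;
    exact: segment_compact.
have := continuous_compact (continuous_subspaceT cf) cB.
move=> /compact_bounded[M [_ fM]]; exists (`|M| + 1) => [|x /UN Bx].
  by rewrite addr_ge0.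
by apply: (fM (`|M| + 1)); [have := ler_norm M; lra|exists x].
Qed.

End measure_rV.

(** * Square-integrable functions and the bilinear forms [ip] and [ipv] *)

Section square_integrable.
Context {R : realType} {d : nat} (Omega : set 'rV[R]_d).
Local Notation T := 'rV[R]_d.
Local Notation leb := (@lebesgue_rV R d).
Local Notation integrableO u := (leb.-integrable Omega (EFin \o u)).
Implicit Types (u v w : T -> R) (g h k : T -> T) (c : R).

Hypothesis mO : measurable Omega.

Lemma le_integrableR u v : measurable_fun Omega u ->
  (forall x, Omega x -> `|u x| <= v x) -> integrableO v -> integrableO u.
Proof.
move=> mu uv; apply: le_integrable => //; first exact/measurable_EFinP.
by move=> x Ox /=; rewrite lee_fin (le_trans (uv _ Ox))// ler_norm.
Qed.

Lemma integrableDR u v : integrableO u -> integrableO v ->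
  integrableO (fun x => u x + v x).
Proof. by move=> iu iv; exact: (integrableD mO iu iv). Qed.

Lemma integrableZR c u : integrableO u -> integrableO (fun x => c * u x).
Proof. by move=> iu; exact: (integrableZl mO c iu). Qed.

Lemma L2_le u v : measurable_fun Omega u -> L2 Omega v ->
  (forall x, Omega x -> `|u x| <= `|v x|) -> L2 Omega u.
Proof.
move=> mu [mv iv] uv; split=> //.
apply: (@le_integrableR (fun x => u x ^+ 2)) iv => [|x Ox].
  exact: measurable_funX.
by rewrite normrX -[v x ^+ 2]real_normK ?num_real ?lerXn2r ?nnegrE// uv.
Qed.

Lemma L2_mul_integrable u v : L2 Omega u -> L2 Omega v ->
  integrableO (fun x => u x * v x).
Proof.
move=> [mu iu] [mv iv].
(* The product is dominated by [u ^+ 2 + v ^+ 2]. *)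
apply: (le_integrableR _ _ (integrableDR iu iv)) => [|x _].
  exact: measurable_funM.
by rewrite ler_norml; apply/andP; split; nra.
Qed.

Lemma L2_lin c u v : L2 Omega u -> L2 Omega v ->
  L2 Omega (fun x => c * u x + v x).
Proof.
move=> [mu iu] [mv iv]; have m : measurable_fun Omega (fun x => c * u x + v x).
  by apply: measurable_funD => //; exact: measurable_funM.
(* The dominating function comes from (cu + v)^2 <= 2 c^2 u^2 + 2 v^2. *)
split=> //; apply: (@le_integrableR (fun x => (c * u x + v x) ^+ 2) _ _ _
  (integrableDR (integrableZR (2 * c ^+ 2) iu) (integrableZR 2 iv))) => [|x _].
  exact: measurable_funX.
by rewrite ger0_norm ?sqr_ge0//=; have := sqr_ge0 (c * u x - v x); nra.
Qed.

Lemma ip_linl c u v w : L2 Omega u -> L2 Omega v -> L2 Omega w ->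
  ip Omega (fun x => c * u x + v x) w = c * ip Omega u w + ip Omega v w.
Proof.
move=> Lu Lv Lw; rewrite /ip.
under eq_Rintegral do rewrite mulrDl -mulrA.
rewrite RintegralD ?RintegralZl//; do ?exact: L2_mul_integrable.
by apply: integrableZR; exact: L2_mul_integrable.
Qed.

Lemma ipC u v : ip Omega u v = ip Omega v u.
Proof. by apply: eq_Rintegral => x _; rewrite mulrC. Qed.

Lemma norm2_sqr u : norm2 Omega u ^+ 2 = ip Omega u u.
Proof.
by rewrite sqr_sqrtr// Rintegral_ge0// => x _; rewrite -expr2 sqr_ge0.
Qed.

Lemma dotv_ge0 (a : T) : 0 <= dotv a a.
Proof. by apply: sumr_ge0 => i _; rewrite -expr2 sqr_ge0. Qed.

Lemma ipv_ge0 g : 0 <= ipv Omega g g.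
Proof. by apply: Rintegral_ge0 => x _; exact: dotv_ge0. Qed.

Lemma norm2v_sqr g : norm2v Omega g ^+ 2 = ipv Omega g g.
Proof. by rewrite sqr_sqrtr// ipv_ge0. Qed.

Lemma ipvC g h : ipv Omega g h = ipv Omega h g.
Proof.
by apply: eq_Rintegral => x _; apply: eq_bigr => i _; rewrite mulrC.
Qed.

Lemma dotv_integrable g h : (forall i, L2 Omega (fun x => g x ord0 i)) ->
  (forall i, L2 Omega (fun x => h x ord0 i)) ->
  integrableO (fun x => dotv (g x) (h x)).
Proof.
move=> Lg Lh.
rewrite (_ : EFin \o _ =
    fun x => (\sum_(i < d) (g x ord0 i * h x ord0 i)%:E)%E).
  by apply: integrable_sum => // i _; exact: L2_mul_integrable.
by apply/funext => x /=; rewrite sumEFin.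
Qed.

Lemma ipv_linl c g h k : (forall i, L2 Omega (fun x => g x ord0 i)) ->
  (forall i, L2 Omega (fun x => h x ord0 i)) ->
  (forall i, L2 Omega (fun x => k x ord0 i)) ->
  ipv Omega (fun x => c *: g x + h x) k = c * ipv Omega g k + ipv Omega h k.
Proof.
move=> Lg Lh Lk; rewrite /ipv.
under eq_Rintegral => x _.
  rewrite (_ : dotv _ _ = c * dotv (g x) (k x) + dotv (h x) (k x)); last first.
    rewrite /dotv mulr_sumr -big_split/=; apply: eq_bigr => i _.
    by rewrite !mxE mulrDl mulrA.
  over.
rewrite RintegralD ?RintegralZl//; do ?exact: dotv_integrable.
by apply: integrableZR; exact: dotv_integrable.
Qed.

Hypothesis fO : (leb Omega < +oo)%E.

Lemma L2_bounded u M : measurable_fun Omega u ->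
  (forall x, Omega x -> `|u x| <= M) -> L2 Omega u.
Proof.
move=> mu uM; split=> //.
apply: (@measurable_bounded_integrable _ _ _ _ (fun x => u x ^+ 2)) => //.
  exact: measurable_funX.
exists (M ^+ 2); split; first exact: num_real.
move=> K MK x Ox /=; rewrite normrX (le_trans _ (ltW MK))//.
by rewrite lerXn2r ?nnegrE ?uM// (le_trans _ (uM x Ox)).
Qed.

Lemma L2_cst c : L2 Omega (fun=> c).
Proof. by apply: (@L2_bounded _ `|c|) => //; exact: measurable_cst. Qed.

Lemma L2_norm u : L2 Omega u -> L2 Omega (fun x => `|u x|).
Proof.
move=> Lu; have [mu _] := Lu; apply: L2_le Lu _ => [|x _].
  by apply: measurableT_comp => //; exact: normr_measurable.
by rewrite normr_id.
Qed.

End square_integrable.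

(** * Growth of the potential and its increment over one step *)

Section nonlinearity.
Context {R : realType} {d : nat} (Omega : set 'rV[R]_d).
Local Notation T := 'rV[R]_d.
Local Notation leb := (@lebesgue_rV R d).
Local Notation integrableO u := (leb.-integrable Omega (EFin \o u)).
Implicit Types (u v w : T -> R).

Hypotheses (mO : measurable Omega) (fO : (leb Omega < +oo)%E).
Context (F : R -> R) (L : R).
Hypotheses (dF : forall t : R, derivable F t 1)
  (d2F : forall t : R, derivable (derive1 F) t 1)
  (lipF : forall x y, `|derive1 F y - derive1 F x| <= L * `|y - x|).

Lemma continuous_derivable1 (g : R -> R) : (forall t : R, derivable g t 1) ->
  continuous g.
Proof.
by move=> dg t; apply/differentiable_continuous; rewrite -derivable1_diffP.
Qed.

(** [derive1 F] grows at most linearly: it is bounded by L|u| + |F'(0)|, and constants are in L^2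
    because [Omega] has finite measure. *)
Lemma L2_derive1_comp u : L2 Omega u -> L2 Omega (derive1 F \o u).
Proof.
move=> Lu; have [mu _] := Lu.
have L' := L2_lin mO L (L2_norm mO Lu) (L2_cst mO fO `|derive1 F 0|).
apply: L2_le L' _ => // [|x _].
  apply: measurableT_comp mu; apply: continuous_measurable_fun.
  exact: continuous_derivable1.
have := lipF 0 (u x); rewrite subr0 => le; apply: le_trans (ler_norm _).
by rewrite -lerBlDr (le_trans _ le)// lerB_dist.
Qed.

(** Taylor at 0 gives quadratic growth: |F(u)| <= (L/2) u^2 + |F'(0) u| + |F(0)|. *)
Lemma integrable_comp u : L2 Omega u -> integrableO (F \o u).
Proof.
move=> Lu; have [mu iu] := Lu.
have i1 := integrableDR mO (integrableZR mO (L / 2) iu)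
  (integrableZR mO `|derive1 F 0|
    (L2_mul_integrable mO (L2_norm mO Lu) (L2_cst mO fO 1))).
have i2 := integrableDR mO i1
  (L2_mul_integrable mO (L2_cst mO fO `|F 0|) (L2_cst mO fO 1)).
apply: le_integrableR i2 => // [|x _] /=.
  apply: measurableT_comp mu; apply: continuous_measurable_fun.
  exact: continuous_derivable1.
rewrite !mulr1; have := taylor1_le dF lipF 0 (u x).
rewrite subr0 -normrM => le.
rewrite -[F (u x)](subrK (F 0)) (le_trans (ler_normD _ _))// lerD2r.
rewrite -[F _ - _](subrK (derive1 F 0 * u x)).
by rewrite (le_trans (ler_normD _ _))// lerD2r.
Qed.

Lemma potential_increment_le x y z :
  F z - F y <= derive1 F ((3 / 2) * y - 2^-1 * x) * (z - y)
    + L / 4 * ((z - y) ^+ 2 + (y - x) ^+ 2 + ((z - y) - (y - x)) ^+ 2).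
Proof.
(* Both Taylor remainders are taken at [p = y + (y - x) / 2]: their sum is
   [L / 2 * (dlt ^+ 2 - dlt * e + e ^+ 2 / 2)] with [dlt = z - y] and
   [e = y - x]. *)
set p := 3 / 2 * y - 2^-1 * x.
have := taylor1_le dF lipF p z; have := taylor1_le dF lipF p y.
rewrite !ler_norml => /andP[+ _] /andP[_ +].
have L0 : 0 <= L.
  by have := lipF 0 1; rewrite subr0 normr1 mulr1; exact: le_trans.
(* The stated bound exceeds the sum of the two remainders by [L / 4 * (y - x) ^+ 2]. *)
have := mulr_ge0 L0 (sqr_ge0 (y - x)).
by set q := derive1 F p; set Fp := F p; rewrite /p; lra.
Qed.

End nonlinearity.

(** * Linearity in the space H^1 *)

Section H1_space.
Context {R : realType} {d : nat} (Omega : set 'rV[R]_d).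
Local Notation T := 'rV[R]_d.
Local Notation leb := (@lebesgue_rV R d).
Implicit Types (u v w : H1pair R d).

Hypotheses (oO : open Omega) (bO : bounded_set Omega).

Let mO : measurable Omega := open_measurable_rV oO.
Let fO : (leb Omega < +oo)%E := bounded_lebesgue_rV_fin mO bO.

Lemma L2_continuous (f : T -> R^o) : continuous f -> L2 Omega f.
Proof.
move=> cf; have [M _ fM] := continuous_bounded_rV bO cf.
apply: (L2_bounded mO fO _ fM).
by apply: measurable_funTS; exact: continuous_measurable_rV.
Qed.

Lemma H1_lin c u v : H1 Omega u -> H1 Omega v -> H1 Omega (c *: u + v).
Proof.
move=> [Lu Lgu wu] [Lv Lgv wv]; split.
- exact: (L2_lin mO c Lu Lv).
- move=> i; rewrite (_ : (fun x => _) =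
    fun x => c * grad u x ord0 i + grad v x ord0 i).
    exact: (L2_lin mO).
  by apply/funext => x; rewrite !mxE.
- move=> psi tpsi i; have [Cpsi _ _] := tpsi.
  (* A test function and its first partial derivatives are continuous, hence in L^2 of the bounded
     [Omega]; this makes the weak-gradient identity linear. *)
  have Lpsi : L2 Omega psi by apply: L2_continuous; case: (Cpsi 0).
  have LDpsi : L2 Omega ('D_(basis_vec i) psi).
    by apply: L2_continuous; have [_ /(_ i)[_ []]] := Cpsi 1.
  rewrite (_ : (fun x => grad (c *: u + v) x ord0 i) =
    fun x => c * grad u x ord0 i + grad v x ord0 i).
    rewrite (ip_linl mO c Lu Lv LDpsi) (ip_linl mO c (Lgu i) (Lgv i) Lpsi).
    by rewrite (wu psi tpsi i) (wv psi tpsi i); ring.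
  by apply/funext => x; rewrite !mxE.
Qed.

Lemma H1B u v : H1 Omega u -> H1 Omega v -> H1 Omega (u - v).
Proof. by move=> Hu Hv; rewrite addrC -scaleN1r; exact: H1_lin. Qed.

Lemma ip_fct_lin c u v w : H1 Omega u -> H1 Omega v -> H1 Omega w ->
  ip Omega (fct (c *: u + v)) (fct w) =
  c * ip Omega (fct u) (fct w) + ip Omega (fct v) (fct w).
Proof. by move=> [Lu _ _] [Lv _ _] [Lw _ _]; exact: (ip_linl mO). Qed.

Lemma ipv_grad_lin c u v w : H1 Omega u -> H1 Omega v -> H1 Omega w ->
  ipv Omega (grad (c *: u + v)) (grad w) =
  c * ipv Omega (grad u) (grad w) + ipv Omega (grad v) (grad w).
Proof. by move=> [_ Lu _] [_ Lv _] [_ Lw _]; exact: (ipv_linl mO). Qed.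

End H1_space.

(** * Integrated form of the energy and of the potential increment *)

Section potential.
Context {R : realType} {d : nat} (Omega : set 'rV[R]_d).
Local Notation T := 'rV[R]_d.
Local Notation leb := (@lebesgue_rV R d).
Implicit Types (u v w : H1pair R d).

Hypotheses (mO : measurable Omega) (fO : (leb Omega < +oo)%E).
Context (F : R -> R) (L : R).
Hypotheses (dF : forall t : R, derivable F t 1)
  (d2F : forall t : R, derivable (derive1 F) t 1)
  (lipF : forall x y, `|derive1 F y - derive1 F x| <= L * `|y - x|).

Lemma energyE eps w : H1 Omega w ->
  energy Omega eps F w = eps / 2 * ipv Omega (grad w) (grad w) +
    eps^-1 * \int[leb]_(x in Omega) F (fct w x).
Proof.
move=> [Lw Lg _]; rewrite /energy /ipv.
have iF := integrable_comp mO fO dF lipF Lw.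
have iG := dotv_integrable mO Lg Lg.
rewrite RintegralD//.
- by rewrite !RintegralZl.
- exact: (integrableZR mO _ iG).
- exact: (integrableZR mO _ iF).
Qed.

(** Integrating the pointwise bound turns its three squares into the squared L^2 norms of both first
    differences and of the second difference, the quantities in the modified energy law. *)
Lemma potential_le u v w : H1 Omega u -> H1 Omega v -> H1 Omega w ->
  \int[leb]_(x in Omega) F (fct w x) - \int[leb]_(x in Omega) F (fct v x) <=
  ip Omega (fun x => derive1 F (fct ((3 / 2) *: v - 2^-1 *: u) x)) (fct (w - v))
  + L / 4 * (ip Omega (fct (w - v)) (fct (w - v))
      + ip Omega (fct (v - u)) (fct (v - u))
      + ip Omega (fct ((w - v) - (v - u))) (fct ((w - v) - (v - u)))).
Proof.
move=> [Lu _ _] [Lv _ _] [Lw _ _].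
have L2B (f g : T -> R) :
    L2 Omega f -> L2 Omega g -> L2 Omega (fun x => f x - g x).
  move=> Lf Lg; rewrite (_ : (fun _ => _) = fun x => -1 * g x + f x).
    exact: L2_lin.
  by apply/funext => x; ring.
have L2Z c (f : T -> R) : L2 Omega f -> L2 Omega (fun x => c * f x).
  move=> Lf; rewrite (_ : (fun _ => _) = fun x => c * f x + 0).
    by apply: (L2_lin mO c Lf); exact: L2_cst.
  by apply/funext => x; ring.
have Lwv := L2B _ _ Lw Lv; have Lvu := L2B _ _ Lv Lu.
have Lq := L2B _ _ Lwv Lvu.
have Lf := L2_derive1_comp mO fO d2F lipF
  (L2B _ _ (L2Z (3 / 2) _ Lv) (L2Z 2^-1 _ Lu)).
have iw := integrable_comp mO fO dF lipF Lw.
have iv := integrable_comp mO fO dF lipF Lv.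
have i1 := L2_mul_integrable mO Lf Lwv.
have i2 := L2_mul_integrable mO Lwv Lwv.
have i3 := L2_mul_integrable mO Lvu Lvu.
have i4 := L2_mul_integrable mO Lq Lq.
have i23 := integrableDR mO i2 i3.
have i234 := integrableDR mO i23 i4.
(* Each side is gathered into a single integral, so that monotonicity applies pointwise. *)
rewrite /ip -RintegralB// -!RintegralD// -RintegralZl//.
rewrite -RintegralD//; last first.
  exact: (integrableZR mO _ i234).
apply: le_Rintegral => //.
- exact: (integrableB mO iw iv).
- exact: (integrableDR mO i1 (integrableZR mO _ i234)).
- by move=> x _; exact: (potential_increment_le dF lipF).
Qed.

End potential.

(** * Algebra of the time differences *)

Section second_differences.
Context {R : realType} {V : lmodType R}.
Implicit Types a b c : V.

Lemma second_differenceE a b c : a - 2 *: b + c = (a - b) - (b - c).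
Proof.
rewrite scaler_nat mulr2n !opprD !opprK !addrA.
by congr (_ + _); rewrite addrAC.
Qed.

(** The right side is nested in the shape [c *: u + v], so that linearity lemmas of that shape apply
    twice. *)
Lemma averageE a b c : 4^-1 *: (3 *: a + c) =
  (3 / 4) *: (a - b) + ((- 4^-1) *: (b - c) + b).
Proof.
have -> : 3 *: a + c = 3 *: (a - b) + (- (b - c) + 4 *: b).
  have -> : 4 *: b = 3 *: b + b.
    by rewrite -[X in _ + X]scale1r -scalerDl; congr (_ *: _); ring.
  rewrite -{1}(subrK b a) -{1}(subKr b c) scalerDr -addrA; congr (_ + _).
  by rewrite addrA addrC.
move: (a - b) (b - c) => x y.
rewrite !scalerDr !scalerA mulVf ?pnatr_eq0// scale1r scalerN scaleNr.
by rewrite (mulrC _ 3).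
Qed.

End second_differences.

(** * The energy inequality for one time step *)

Section energy_step.
Context {R : realType} {d : nat} (Omega : set 'rV[R]_d).
Implicit Types (u v w : H1pair R d).
Local Notation leb := (@lebesgue_rV R d).
Local Notation M u v := (ip Omega (fct u) (fct v)).
Local Notation S u v := (ipv Omega (grad u) (grad v)).

Hypotheses (oO : open Omega) (bO : bounded_set Omega).

Lemma ipv_grad_linr c u v w : H1 Omega u -> H1 Omega v -> H1 Omega w ->
  S w (c *: u + v) = c * S w u + S w v.
Proof.
move=> Hu Hv Hw; rewrite ipvC ipv_grad_lin// (ipvC _ (grad u)).
by rewrite (ipvC _ (grad v)).
Qed.

Lemma ipv_grad_sqr c u v : H1 Omega u -> H1 Omega v ->
  S (c *: u + v) (c *: u + v) = c ^+ 2 * S u u + 2 * c * S u v + S v v.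
Proof.
move=> Hu Hv; have Huv : H1 Omega (c *: u + v) by exact: H1_lin.
rewrite ipv_grad_lin// !ipv_grad_linr// (ipvC _ (grad v) (grad u)); ring.
Qed.

Lemma ip_fct_sqr c u v : H1 Omega u -> H1 Omega v ->
  M (c *: u + v) (c *: u + v) = c ^+ 2 * M u u + 2 * c * M u v + M v v.
Proof.
move=> Hu Hv; have Huv : H1 Omega (c *: u + v) by exact: H1_lin.
rewrite ip_fct_lin// (ipC _ (fct u) (fct (_ + _))).
rewrite (ipC _ (fct v) (fct (_ + _))) !ip_fct_lin//.
rewrite (ipC _ (fct v) (fct u)); ring.
Qed.

Lemma ip_fctZ c u w : H1 Omega u -> H1 Omega w ->
  M (c *: u) w = c * M u w.
Proof.
move=> [Lu _ _] [Lw _ _]; rewrite /ip -RintegralZl//; first last.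
- exact: (L2_mul_integrable (open_measurable_rV oO)).
- exact: open_measurable_rV.
by apply: eq_Rintegral => x _; rewrite mulrA.
Qed.

(** Here [a], [b], [c], [m] stand for phi^{n+1}, phi^n, phi^{n-1}, mu^{n+1/2}, and [s] for sqrt(A /
    gamma). The three equations are the scheme tested with [m] and with [a - b]. *)
Lemma energy_step (eps gamma tau A B L s : R) (F : R -> R) a b c m :
  0 < eps -> 0 < gamma -> 0 < tau -> s ^+ 2 * gamma = A ->
  (forall t : R, derivable F t 1) ->
  (forall t : R, derivable (derive1 F) t 1) ->
  (forall x y, `|derive1 F y - derive1 F x| <= L * `|y - x|) ->
  H1 Omega a -> H1 Omega b -> H1 Omega c -> H1 Omega m ->
  M (tau^-1 *: (a - b)) m = - gamma * S m m ->
  M (tau^-1 *: (a - b)) (a - b) = - gamma * S m (a - b) ->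
  M m (a - b) = eps * S (4^-1 *: (3 *: a + c)) (a - b)
    + eps^-1 * ip Omega (fun x => derive1 F (fct ((3 / 2) *: b - 2^-1 *: c) x))
        (fct (a - b))
    + A * tau * S (a - b) (a - b) + B * M (a - 2 *: b + c) (a - b) ->
  energy Omega eps F a + (L / (4 * eps) + B / 2) * M (a - b) (a - b)
    + eps / 8 * S (a - b) (a - b) <=
  energy Omega eps F b + (L / (4 * eps) + B / 2) * M (b - c) (b - c)
    + eps / 8 * S (b - c) (b - c)
    - (2 * s - L / (2 * eps)) * M (a - b) (a - b)
    - (B / 2 - L / (4 * eps)) * M (a - 2 *: b + c) (a - 2 *: b + c)
    - eps / 8 * S (a - 2 *: b + c) (a - 2 *: b + c).
Proof.
move=> eps0 gamma0 tau0 sA dF d2F lipF Ha Hb Hc Hm.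
have mO := open_measurable_rV oO; have fO := bounded_lebesgue_rV_fin mO bO.
have Hd := H1B oO bO Ha Hb; have He := H1B oO bO Hb Hc.
rewrite !ip_fctZ// (averageE a b c) => eq1 eq2.
have Heb x : H1 Omega (x *: (b - c) + b) by exact: H1_lin.
have pot := potential_le mO fO dF d2F lipF Hc Hb Ha.
rewrite second_differenceE; move: pot.
have -> : (a - b) - (b - c) = (-1) *: (b - c) + (a - b).
  by rewrite scaleN1r addrC.
rewrite (ipv_grad_lin oO (3 / 4))// (ipv_grad_lin oO (- 4^-1))//.
rewrite (ip_fct_lin oO (-1) He Hd Hd) !ip_fct_sqr// ipv_grad_sqr//.
rewrite (energyE mO fO dF lipF eps Ha) (energyE mO fO dF lipF eps Hb).
(* Expanding around [b] produces the cross term [S (a - b) b], which cancels the one coming from the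
   averaged gradient. *)
have -> : S a a = S (a - b) (a - b) + 2 * S (a - b) b + S b b.
  rewrite -{1 2}(subrK b a) -{1 2}[a - b]scale1r.
  by rewrite ipv_grad_sqr// expr1n !mul1r mulr1.
(* [s] is such that the expansion of this square has the coefficient [A * tau]
   of the stabilization term once multiplied by [gamma * tau]. *)
have cs : 0 <= S (s *: (a - b) + m) (s *: (a - b) + m) := ipv_ge0 _ _.
rewrite ipv_grad_sqr// in cs.
rewrite (ipC _ (fct m)) (ipvC _ (grad b)).
rewrite (ipvC _ (grad m)) in eq2.
move: eq1 eq2 cs.
set G := ip Omega (fun x => derive1 F _) _.
set IFa := Rintegral _ _ (fun x => F (fct a x)).
set IFb := Rintegral _ _ (fun x => F (fct b x)).
(* All integrals become real unknowns: what remains is algebra. *)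
move: G IFa IFb (M (a - b) m) (M (a - b) (a - b)) (M (b - c) (a - b))
  (M (b - c) (b - c)).
move=> G IFa IFb Mdm Mdd Med Mee.
move: (S (a - b) (a - b)) (S (a - b) m) (S m m) (S (a - b) b) (S b b)
  (S (b - c) (a - b)) (S (b - c) (b - c)) => Sdd Sdm Smm Sdb Sbb Sed See.
move=> eq1 eq2 cs pot eq3.
(* Multiplying by [tau] expresses [M (a - b) m] and [M (a - b) (a - b)] through gradient
   products. *)
have tK x y : tau^-1 * x = - gamma * y -> x = - (gamma * tau * y).
  by move=> xy; rewrite -[x](mulVKf (lt0r_neq0 tau0)) xy; ring.
have {}eq1 := tK _ _ eq1; have {}eq2 := tK _ _ eq2.
have {}cs := mulr_ge0 (ltW (mulr_gt0 gamma0 tau0)) cs.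
have {}pot := ler_wpM2l (ltW (divr_gt0 ltr01 eps0)) pot.
rewrite !invfM.
move: (eps^-1) pot eq3 => k pot eq3.
(* After these substitutions the goal is a linear combination of [cs], [pot] and [eq3], with
   monomials as unknowns. The terms with [B] and [eps / 8] telescope by 2(q, d) = |d|^2 - |e|^2 +
   |q|^2 and 2(e, d) = |d|^2 + |e|^2 - |q|^2, where q = d - e. *)
rewrite -sA eq1 in eq3; rewrite eq2 in pot eq3 *.
lra.
Qed.

End energy_step.

(** * Energy law of the scheme, from the one-step inequality *)

Theorem theorem2p1 (R : realType) (d : nat) (hd : (1 <= d <= 3)%N)
  (Omega : set 'rV[R]_d) (hOmega : bounded_domain Omega)
  (hLip : (2 <= d)%N -> locally_lipschitz_boundary Omega)
  (eps gamma tau : R) (heps : 0 < eps) (hgamma : 0 < gamma) (htau : 0 < tau)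
  (F f : R -> R) (hF : C2 F) (hf : f = derive1 F)
  (L : R) (hL0 : 0 <= L) (hL : forall x, `|derive1 f x| <= L)
  (A B : R) (hA0 : 0 <= A) (hB0 : 0 <= B)
  (hA : L ^+ 2 / (16 * eps ^+ 2) * gamma <= A)
  (hB : L / (2 * eps) <= B)
  (phi mu : nat -> H1pair R d)
  (hphi : forall n, H1 Omega (phi n))
  (hmu : forall n, (1 <= n)%N -> H1 Omega (mu n))
  (hscheme : SLD_CN Omega eps gamma tau A B f phi mu) :
  forall n, (1 <= n)%N ->
    modified_energy Omega eps L B F phi n.+1 <=
      modified_energy Omega eps L B F phi n
      - (2 * Num.sqrt (A / gamma) - L / (2 * eps))
          * norm2 Omega (fct (delta_t phi n.+1)) ^+ 2
      - (B / 2 - L / (4 * eps))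
          * norm2 Omega (fct (delta_tt phi n.+1)) ^+ 2
      - eps / 8 * norm2v Omega (grad (delta_tt phi n.+1)) ^+ 2.
Proof.
have [oO _ _ bO] := hOmega.
have [dF d2F _] := hF.
have lipF : forall x y, `|derive1 F y - derive1 F x| <= L * `|y - x|.
  by apply: lipschitz_derive1 => // t; rewrite -hf.
(* With the index written as a successor, the predecessors in [delta_t] and [delta_tt] compute; the
   three time levels are now [n.+2], [n.+1] and [n]. *)
case=> [//|n _].
have := norm2v_sqr Omega (grad (delta_tt phi n.+2)).
have := norm2_sqr Omega (fct (delta_tt phi n.+2)).
have := norm2_sqr Omega (fct (delta_t phi n.+2)).
have := norm2v_sqr Omega (grad (delta_t phi n.+2)).
have := norm2_sqr Omega (fct (delta_t phi n.+1)).
have := norm2v_sqr Omega (grad (delta_t phi n.+1)).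
rewrite /modified_energy.
(* Unifying [norm2] with [norm2v] unfolds both down to the integrals, so the
   norms are generalized before their squares are rewritten. *)
move: (norm2v Omega (grad (delta_tt phi n.+2))) => ndtt.
move: (norm2 Omega (fct (delta_tt phi n.+2))) => mdtt.
move: (norm2v Omega (grad (delta_t phi n.+1))) => ndt.
move: (norm2 Omega (fct (delta_t phi n.+1))) => mdt.
move: (norm2 Omega (fct (delta_t phi n.+2))) => mdt'.
move: (norm2v Omega (grad (delta_t phi n.+2))) => ndt'.
move=> -> -> -> -> -> ->.
have Hd := H1B oO bO (hphi n.+2) (hphi n.+1).
have [e1 _] := hscheme n.+1 isT _ (hmu n.+1 isT).
have [e2 e3] := hscheme n.+1 isT _ Hd.
rewrite hf in e3.
apply: (energy_step oO bO heps hgamma htau _ dF d2F lipF (hphi _)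
  (hphi _) (hphi _) (hmu n.+1 isT) e1 e2 e3).
(* The remaining condition is [s ^+ 2 * gamma = A] for [s = Num.sqrt (A / gamma)]. *)
by rewrite sqr_sqrtr ?divfK ?gt_eqF// divr_ge0// ltW.
Qed.
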